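(* Let $N\ge 2$, and consider the $N$-NOPA coherent feedback system without time delays, with pump parameter $x$ ($0<x\le 1$) and system matrix $A_N(x)\in\mathbb{R}^{4N\times 4N}$ as defined in the context. Let $x_{th}\le 1$ be the smallest positive root of $\det(A_N(x))$, regarded as a polynomial in $x$. Then the system with parameter $x$ is stable if and only if $0<x<x_{th}$.
   Context: Parameters: $\gamma_r=7.2\times 10^7$; $\gamma=\gamma_r/y$ with a fixed real $y$, $0<y\le 1$; the pump amplitude is $\epsilon=x\gamma_r$ with real $x$, $0<x\le 1$; $\alpha\in(0,1]$ is the transmission rate of each beamsplitter, $\alpha=10^{-0.01d/(N-1)}$ for total distance $d$ km, and $\alpha=1$ when there are no transmission losses; $\kappa\ge 0$ is the amplification loss rate, taken to be $\kappa=\frac{3\times 10^6}{0.6\sqrt{2}}\,x$ when amplification losses are present and $\kappa=0$ when they are absent. Define the $4\times 4$ matrices $A_0=-\frac{\gamma+\kappa}{2}I_4$, $A_a=\mathrm{diag}(-\gamma,-\gamma,0,0)$, $A_b=\mathrm{diag}(0,0,-\gamma,-\gamma)$ and $$\Delta_0(x)=\gamma_r\begin{bmatrix}0&0&\frac{x}{2}&0\\0&0&0&-\frac{x}{2}\\\frac{x}{2}&0&0&0\\0&-\frac{x}{2}&0&0\end{bmatrix}.$$ The system matrix $A_N(x)$ is the real $4N\times 4N$ matrix which, viewed as an $N\times N$ array of $4\times 4$ blocks, has $(i,j)$ block equal to $A_0+\Delta_0(x)$ if $i=j$, to $\alpha^{j-i}A_b$ if $i<j$, and to $\alpha^{i-j}A_a$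 if $i>j$. In the absence of time delays, the vector $z$ of the $4N$ quadratures of the cavity modes satisfies the linear quantum stochastic differential equation $\dot z(t)=A_N(x)z(t)+B_N\xi(t)$ with vacuum noise inputs $\xi$ and a constant real matrix $B_N$, so its mean satisfies $\frac{d}{dt}\langle z\rangle=A_N(x)\langle z\rangle$. Stability means that $\langle z(t)\rangle\to 0$ as $t\to\infty$ and that the Lyapunov equation $A_N P+PA_N^T+B_NB_N^T=0$ has a unique solution $P$; this is expressed by the condition that $A_N(x)$ is Hurwitz, i.e. all eigenvalues of $A_N(x)$ have negative real part. *)

(* Defs.v *)
From HB Require Import structures.
From mathcomp Require Import all_boot all_order all_algebra.
From mathcomp Require Import complex.
From mathcomp Require Import reals.

Set Implicit Arguments.
Unset Strict Implicit.
Unset Printing Implicit Defensive.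

Import Order.TTheory GRing.Theory Num.Theory.

Local Open Scope ring_scope.

(* Over a general [S], the same definition yields the real matrix A_N(x)
   ([S := R]) and the matrix of polynomials in the pump parameter
   ([S := {poly R}], [x := 'X]). *)
Section Blocks.
Variable S : comUnitRingType.
Implicit Types gr g k al x : S.

Definition mx4 (s : seq (seq S)) : 'M[S]_4 :=
  \matrix_(i, j) nth 0 (nth [::] s i) j.

Definition A0 g k : 'M[S]_4 := (- ((g + k) / 2))%:M.

Definition Aa g : 'M[S]_4 :=
  mx4 [:: [:: - g;   0; 0; 0];
          [::   0; - g; 0; 0];
          [::   0;   0; 0; 0];
          [::   0;   0; 0; 0]].

Definition Ab g : 'M[S]_4 :=
  mx4 [:: [:: 0; 0;   0;   0];
          [:: 0; 0;   0;   0];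
          [:: 0; 0; - g;   0];
          [:: 0; 0;   0; - g]].

Definition Delta0 gr x : 'M[S]_4 :=
  gr *: mx4 [:: [::     0;         0; x / 2;         0];
                [::     0;         0;     0; - (x / 2)];
                [:: x / 2;         0;     0;         0];
                [::     0; - (x / 2);     0;         0]].

Definition block gr g k al x (i j : nat) : 'M[S]_4 :=
  if i == j then A0 g k + Delta0 gr x
  else if (i < j)%N then al ^+ (j - i) *: Ab g
  else al ^+ (i - j) *: Aa g.

Definition block_system (N : nat) gr g k al x : 'M[S]_(\sum_(i < N) 4) :=
  \mxblock_(i < N, j < N) block gr g k al x i j.

End Blocks.

Section System.
Variable R : realType.
Implicit Types y alpha x : R.

Definition gamma_r : R := 72 / 10 * 10 ^+ 7.

Definition gamma y : R := gamma_r / y.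

(* The amplification loss rate is kappa = kappa_coef amp * x, where [amp] tells
   whether amplification losses are present. *)
Definition kappa_coef (amp : bool) : R :=
  if amp then 3 * 10 ^+ 6 / (6 / 10 * Num.sqrt 2) else 0.

Definition AN (N : nat) y alpha (amp : bool) x : 'M[R]_(\sum_(i < N) 4) :=
  block_system N gamma_r (gamma y) (kappa_coef amp * x) alpha x.

Definition AN_poly (N : nat) y alpha (amp : bool) :
    'M[{poly R}]_(\sum_(i < N) 4) :=
  block_system N gamma_r%:P (gamma y)%:P ((kappa_coef amp)%:P * 'X) alpha%:P 'X.

Lemma horner_AN_poly (N : nat) y alpha amp x :
  map_mx (horner_eval x) (AN_poly N y alpha amp) = AN N y alpha amp x.
Proof.
have h2 : (2^-1 : {poly R}) = (2^-1)%:P by rewrite -[2 in LHS]polyC_natr polyCV.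
apply/matrixP => p q; rewrite !mxE /horner_eval.
move: (tagnat.sig1 p) (tagnat.sig1 q) => i j.
move: (tagnat.sig2 p) (tagnat.sig2 q) => u v.
by rewrite /block; case: ifP => _; last case: ifP => _; rewrite !mxE ?h2;
  try case: (u == v); case: u => [[|[|[|[|?]]]] hu] //;
  case: v => [[|[|[|[|?]]]] hv] //=; rewrite !hornerE.
Qed.

Lemma horner_det_AN_poly (N : nat) y alpha amp x :
  (\det (AN_poly N y alpha amp)).[x] = \det (AN N y alpha amp x).
Proof. by rewrite -horner_AN_poly det_map_mx. Qed.

Definition hurwitz (n : nat) (A : 'M[R]_n) : Prop :=
  forall l : R[i], eigenvalue (map_mx (real_complex R) A) l -> complex.Re l < 0.

Definition smallest_positive_root (p : {poly R}) (r : R) : Prop :=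
  [/\ 0 < r, root p r & forall s : R, 0 < s -> root p s -> r <= s].

End System.

(* Main.v *)
Require Import Defs.
From mathcomp Require Import all_boot all_order all_algebra.
From mathcomp Require Import complex.
From mathcomp Require Import boolp classical_sets reals.
From mathcomp Require Import ring lra.
Import Order.TTheory GRing.Theory Num.Theory.
Local Open Scope ring_scope.

Set Implicit Arguments.
Unset Strict Implicit.
Unset Printing Implicit Defensive.

(* The four quadratures decouple into two copies (up to a sign) of the system
   [u (l + K) = c v], [v (l + K^T) = c u] for left eigenvectors, where
   [K = (gamma + kappa)/2 + gamma L] with [L] the strictly lower triangular
   matrix of the powers of alpha, and [c = gamma_r x / 2].  Eliminating [v]
   gives the self-adjoint quadratic pencil
     [u (l^2 + l (K + K^T) + K K^T - c^2) = 0],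
   a damped oscillator: [K + K^T] is positive semidefinite because the kernel
   [alpha^|i - j|] is.  If [K K^T - c^2] is positive definite, every [l] thus
   has negative real part, the imaginary axis being excluded by triangularity
   of [K].  If it is not, definiteness of [(l + K)(l + K^T) - c^2] is lost at
   some real [l >= 0], which is then an eigenvalue.  So stability means
   [K K^T - c^2 > 0].  As [x] grows from 0 this can first fail only where the
   determinant vanishes, and once it has failed it fails for all larger [x],
   since [kappa] grows no faster than [gamma_r x]. *)

(** * Real quadratic forms: Cauchy-Schwarz, boundedness, coercivity *)

Definition dot (F : pzRingType) n (u w : 'rV[F]_n) : F := (u *m w^T) 0 0.

Definition posdef (F : numDomainType) n (Q : 'M[F]_n) : Prop :=
  forall u : 'rV_n, u != 0 -> 0 < dot (u *m Q) u.

Section Dot.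
Variables (R : realFieldType) (n : nat).
Implicit Types (u v w : 'rV[R]_n) (Q W : 'M[R]_n) (a : R).

Lemma dotE u w : dot u w = \sum_i u 0 i * w 0 i.
Proof. by rewrite /dot mxE; apply: eq_bigr => i _; rewrite mxE. Qed.

Lemma dotC u w : dot u w = dot w u.
Proof. by rewrite !dotE; apply: eq_bigr => i _; rewrite mulrC. Qed.

Lemma dotDl u v w : dot (u + v) w = dot u w + dot v w.
Proof. by rewrite /dot mulmxDl mxE. Qed.

Lemma dotZl a u w : dot (a *: u) w = a * dot u w.
Proof. by rewrite /dot -scalemxAl mxE. Qed.

Lemma dotNl u w : dot (- u) w = - dot u w.
Proof. by rewrite -scaleN1r dotZl mulN1r. Qed.

Lemma dotBl u v w : dot (u - v) w = dot u w - dot v w.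
Proof. by rewrite dotDl dotNl. Qed.

Lemma dotDr u v w : dot w (u + v) = dot w u + dot w v.
Proof. by rewrite !(dotC w) dotDl. Qed.

Lemma dotZr a u w : dot w (a *: u) = a * dot w u.
Proof. by rewrite !(dotC w) dotZl. Qed.

Lemma dot0l u : dot 0 u = 0.
Proof. by rewrite /dot mul0mx mxE. Qed.

Lemma dot_mulmx u w W : dot (u *m W) w = dot u (w *m W^T).
Proof. by rewrite /dot trmx_mul trmxK mulmxA. Qed.

Lemma dot_ge0 u : 0 <= dot u u.
Proof. by rewrite dotE sumr_ge0 // => i _; rewrite -expr2 sqr_ge0. Qed.

Lemma dot_eq0 u : (dot u u == 0) = (u == 0).
Proof.
apply/eqP/eqP => [|->]; last exact: dot0l.
rewrite dotE => /eqP; rewrite psumr_eq0 => [/allP h|i _]; last first.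
  by rewrite -expr2 sqr_ge0.
apply/rowP => i; rewrite mxE.
by have /eqP := h i (mem_index_enum i); rewrite -expr2 => /eqP; rewrite sqrf_eq0 => /eqP.
Qed.

Lemma dot_gt0 u : (0 < dot u u) = (u != 0).
Proof. by rewrite lt_def dot_eq0 dot_ge0 andbT. Qed.

Section Semidefinite.
Variable Q : 'M[R]_n.
Hypothesis (Qsym : Q^T = Q) (Qge0 : forall u, 0 <= dot (u *m Q) u).

Lemma psd_cauchy_schwarz u w :
  dot (u *m Q) w ^+ 2 <= dot (u *m Q) u * dot (w *m Q) w.
Proof.
have sym : dot (w *m Q) u = dot (u *m Q) w by rewrite dot_mulmx Qsym dotC.
have E a b : 0 <= a ^+ 2 * dot (u *m Q) u + 2 * a * b * dot (u *m Q) w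
                + b ^+ 2 * dot (w *m Q) w.
  have := Qge0 (a *: u + b *: w).
  rewrite mulmxDl -!scalemxAl !dotDl !dotDr !dotZl !dotZr sym.
  by congr (_ <= _); ring.
move: E (Qge0 u) (Qge0 w); set p := dot _ _; set q := dot (w *m Q) w.
set r := dot _ _ => E; rewrite le_eqVlt => /orP[/eqP p0|p0] q0; last first.
  (* For p > 0, the form at -r u + p w equals p (p q - r^2). *)
  by rewrite -(ler_pM2l p0); have := E (- r) p; lra.
(* For p = 0, the form at -(q + 1) u + r w equals -(q + 2) r^2, so r = 0. *)
have := E (- (q + 1)) r; have := mulr_ge0 (sqr_ge0 r) q0.
by have := sqr_ge0 r; rewrite -p0 mul0r mulr0; lra.
Qed.

(** Cauchy-Schwarz against [w = u *m Q] bounds the fourth power of the length of [u *m Q] by 0. *)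
Lemma psd_null u : dot (u *m Q) u = 0 -> u *m Q = 0.
Proof.
move=> u0; have := psd_cauchy_schwarz u (u *m Q).
rewrite u0 mul0r => h; apply/eqP; rewrite -dot_eq0 -sqrf_eq0.
by apply/eqP/le_anti; rewrite h sqr_ge0.
Qed.

End Semidefinite.

Lemma cauchy_schwarz u w : dot u w ^+ 2 <= dot u u * dot w w.
Proof.
have := @psd_cauchy_schwarz 1%:M (trmx1 _ _) _ u w.
by rewrite !mulmx1; apply=> v; rewrite mulmx1 dot_ge0.
Qed.

Lemma form_bounded W : exists2 C, 0 <= C &
  forall u, `|dot (u *m W) u| <= C * dot u u.
Proof.
exists (\sum_j \sum_i `|W i j|) => [|u].
  by apply: sumr_ge0 => j _; apply: sumr_ge0.
rewrite [dot (_ *m _) _]dotE mulr_suml (le_trans (ler_norm_sum _ _ _)) //.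
apply: ler_sum => j _; rewrite mxE !mulr_suml (le_trans (ler_norm_sum _ _ _)) //.
apply: ler_sum => i _; rewrite !normrM mulrAC mulrC ler_wpM2l //.
have le k : `|u 0 k| ^+ 2 <= dot u u.
  rewrite real_normK ?num_real // dotE (bigD1 k) //= expr2 lerDl.
  by apply: sumr_ge0 => ? _; rewrite -expr2 sqr_ge0.
have := le i; have := le j; nra.
Qed.

Lemma posdef_psd Q : posdef Q -> forall u, 0 <= dot (u *m Q) u.
Proof.
by move=> Qpos u; case: (eqVneq u 0) => [->|/Qpos/ltW//]; rewrite mul0mx dot0l.
Qed.

Lemma posdef_det Q : posdef Q -> \det Q != 0.
Proof.
move=> Qpos; apply/det0P => -[u u0 uQ].
by have := Qpos u u0; rewrite uQ dot0l ltxx.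
Qed.

(* Cauchy-Schwarz for the form, applied to [u] and [u *m invmx Q]. *)
Lemma psd_coercive Q : Q^T = Q -> (forall u, 0 <= dot (u *m Q) u) ->
  \det Q != 0 -> exists2 m, 0 < m & forall u, m * dot u u <= dot (u *m Q) u.
Proof.
move=> Qsym Qge0 detQ.
have Qunit : Q \in unitmx by rewrite unitmxE unitfE.
have [C C0 hC] := form_bounded (invmx Q).
exists (C + 1)^-1 => [|u]; first by rewrite invr_gt0; lra.
rewrite ler_pdivrMl; last lra.
have := psd_cauchy_schwarz Qsym Qge0 u (u *m invmx Q).
have -> : dot (u *m Q) (u *m invmx Q) = dot u u.
  by rewrite dot_mulmx Qsym mulmxKV.
rewrite mulmxKV // (dotC u (u *m _)).
have := ler_normlW (hC u); have := dot_ge0 u; have := Qge0 u.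
case: (ltgtP (dot u u) 0) => [||->] //; last by nra.
move=> u0 q0 _; set d := dot u u in u0 *; set q := dot (u *m Q) u in q0 *.
move=> h1 h2; rewrite -(ler_pM2l u0); nra.
Qed.

End Dot.

(** * Loss of definiteness along a quadratic family of symmetric matrices *)

Section QuadraticPencil.
Variables (R : realType) (n : nat) (Q0 Q1 Q2 : 'M[R]_n).

(** Serves twice: with s = -l to find real eigenvalues, and with s = x to follow the pump
    parameter. *)
Definition pencil (s : R) : 'M[R]_n := Q0 + s *: Q1 + s ^+ 2 *: Q2.

Hypotheses (sym0 : Q0^T = Q0) (sym1 : Q1^T = Q1) (sym2 : Q2^T = Q2).

Lemma pencil_sym s : (pencil s)^T = pencil s.
Proof. by rewrite /pencil !linearD !linearZ /= sym0 sym1 sym2. Qed.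

Lemma pencil_form s u : dot (u *m pencil s) u =
  dot (u *m Q0) u + s * dot (u *m Q1) u + s ^+ 2 * dot (u *m Q2) u.
Proof. by rewrite /pencil !mulmxDr -!scalemxAr !dotDl !dotZl. Qed.

Lemma pencil_lipschitz a b : exists2 C, 0 < C &
  forall s t u, a <= s <= b -> a <= t <= b ->
    `|dot (u *m pencil s) u - dot (u *m pencil t) u| <= C * `|s - t| * dot u u.
Proof.
have [C1 C10 h1] := form_bounded Q1; have [C2 C20 h2] := form_bounded Q2.
(* The difference quotient is the form of Q1 + (s + t) Q2, with |s + t| <= 2 (|a| + |b|); the 1
   makes the constant positive. *)
exists (1 + C1 + 2 * (`|a| + `|b|) * C2) => [|s t u sab tab].
  have : 0 <= (`|a| + `|b|) * C2 by rewrite mulr_ge0 // addr_ge0.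
  by lra.
rewrite !pencil_form.
have -> : forall p q r : R, p + s * q + s ^+ 2 * r - (p + t * q + t ^+ 2 * r)
    = (s - t) * (q + (s + t) * r) by move=> *; ring.
rewrite normrM mulrAC mulrC ler_wpM2r //.
rewrite (le_trans (ler_normD _ _)) // normrM.
have st : `|s + t| <= 2 * (`|a| + `|b|).
  have := ler_norm b; have := ler_norm (- a); rewrite normrN.
  have := normr_ge0 a; have := normr_ge0 b.
  by rewrite ler_norml; lra.
have : `|s + t| * `|dot (u *m Q2) u| <= 2 * (`|a| + `|b|) * (C2 * dot u u).
  by apply: ler_pM.
have := h1 u; have := dot_ge0 u; lra.
Qed.

Local Open Scope classical_set_scope.

(* The first parameter at which definiteness fails gives a semidefinite form;
   were it nonsingular, it would be coercive and definiteness would persist. *)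
Lemma pencil_singular a b : a < b -> posdef (pencil a) -> ~ posdef (pencil b) ->
  exists2 s, a < s <= b & \det (pencil s) = 0.
Proof.
move=> ab pa npb.
pose E := [set s | a <= s <= b /\ forall t, a <= t <= s -> posdef (pencil t)].
have Ea : E a.
  by split=> [|t]; [rewrite lexx ltW|move=> /le_anti <-].
have Eb : ubound E b by move=> s [/andP[]].
have supE : has_sup E by split; [exists a|exists b].
pose s := sup E.
have sab : a <= s <= b.
  by rewrite (sup_upper_bound supE) //= ge_sup //; exists a.
have [C C0 lip] := pencil_lipschitz a b.
(* A negative value at [s] would survive at points of [E] closer than [e], where the form is
   definite. *)
have psd u : 0 <= dot (u *m pencil s) u.
  rewrite leNgt; apply/negP => neg.
  have u0 : u != 0 by apply: contraTneq neg => ->; rewrite mul0mx dot0l ltxx.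
  have d0 : 0 < C * dot u u by rewrite mulr_gt0 ?dot_gt0.
  pose e := - dot (u *m pencil s) u / (C * dot u u).
  have e0 : 0 < e by rewrite divr_gt0 // oppr_gt0.
  have [t [tab Et] st] := sup_adherent e0 supE.
  have ts : t <= s by apply: (sup_upper_bound supE); split.
  have := lip s t u sab tab; rewrite (ger0_norm (_ : 0 <= s - t)) ?subr_ge0 //.
  have tpos : 0 < dot (u *m pencil t) u by apply: Et; rewrite ?u0 // lexx; case/andP: tab => ->.
  have : (s - t) * (C * dot u u) < - dot (u *m pencil s) u.
    by rewrite -ltr_pdivlMr // -/e; rewrite -/s in st; lra.
  move=> h1; rewrite ler_norml => /andP[h2 h3]; nra.
have ds : \det (pencil s) = 0.
  apply/eqP/negPn/negP => /(psd_coercive (pencil_sym s) psd)[m m0 hm].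
  (* Half the radius m / C within which coercivity outweighs the Lipschitz drift. *)
  pose d := m / (2 * C); have d0 : 0 < d by rewrite divr_gt0 //; lra.
  have dC : C * d < m by rewrite /d invfM mulrCA [C * _]mulrCA divff ?gt_eqF //; lra.
  have near t : a <= t <= b -> `|t - s| <= d -> posdef (pencil t).
    move=> tab ts u u0; have := lip t s u tab sab; have := hm u.
    have : C * `|t - s| * dot u u < m * dot u u.
      by rewrite ltr_pM2r ?dot_gt0 // (le_lt_trans _ dC) // ler_pM2l.
    by rewrite ler_norml => ? ? /andP[]; lra.
  have below t : a <= t < s -> posdef (pencil t).
    move=> /andP[at_ ts]; have st0 : 0 < s - t by lra.
    have [r [_ Er] rt] := sup_adherent st0 supE.
    by apply: Er; rewrite at_ /=; rewrite -/s in rt; lra.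
  (* Definiteness extends to min(b, s + d). As [s] is the supremum, b <= s, so the form would be
     definite at [b]. *)
  have Emin : E (Num.min b (s + d)).
    split=> [|t]; first by rewrite le_min ge_min lexx; lra.
    rewrite le_min => /and3P[at_ tb tsd].
    case: (ltP t s) => ts; first by apply: below; rewrite at_.
    by apply: near; rewrite ?at_ // ger0_norm; lra.
  have := sup_upper_bound supE Emin; rewrite -/s ge_min.
  case: (leP b s) => [bs _|/= sb]; last by lra.
  by apply: npb; apply: near; rewrite ?lexx ?ltW //= ger0_norm; lra.
exists s => //; case/andP: sab => as_ ->; rewrite andbT lt_neqAle as_ andbT.
by apply: contraTneq (posdef_det pa) => ->; rewrite ds eqxx.
Qed.

End QuadraticPencil.

(** * Decoupling of the quadratures into pairs of modes *)

Section Modes.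
Variables (F : fieldType) (N : nat).
Implicit Types (gr g k al x l c : F) (u v : 'rV[F]_N).

Definition cascade_mx al : 'M[F]_N :=
  \matrix_(i, j) if (j < i)%N then al ^+ (i - j) else 0.

Definition mode_mx g k al : 'M[F]_N := ((g + k) / 2)%:M + g *: cascade_mx al.

Definition coupled_modes (K : 'M[F]_N) c l u v : Prop :=
  u *m (l%:M + K) = c *: v /\ v *m (l%:M + K^T) = c *: u.

Definition interleave (w : 'I_4 -> 'rV[F]_N) : 'rV[F]_(\sum_(i < N) 4) :=
  \mxrow_i \row_m w m 0 i.

Lemma interleave_surj z : exists w, z = interleave w.
Proof.
exists (fun m => \row_i submxrow z i 0 m); rewrite -[LHS]submxrowK.
by apply/eq_mxrowP => i; apply/rowP => m; rewrite [RHS]mxE [RHS]mxE.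
Qed.

Lemma interleave_inj w w' : interleave w = interleave w' -> w =1 w'.
Proof.
rewrite /interleave => /eq_mxrowP ww m; apply/rowP => i.
by have /rowP/(_ m) := ww i; rewrite !mxE.
Qed.

Lemma interleaveZ a w : a *: interleave w = interleave (fun m => a *: w m).
Proof.
rewrite -[LHS]submxrowK; apply/eq_mxrowP => i; apply/rowP => m.
have -> : submxrow (a *: interleave w) i = a *: submxrow (interleave w) i.
  by apply/matrixP => ? ?; rewrite !mxE.
by rewrite mxrowK !mxE.
Qed.

(** The default [a] of [nth] is never reached, as m < 4. *)
Definition I4 (T : Type) (a b c d : T) (m : 'I_4) : T := nth a [:: a; b; c; d] m.

(** [Aa] acts below the diagonal on quadratures 0 and 1, [Ab] above it on 2 and 3: hence [K] for the
    former and [K^T] for the latter. The pump couples 0 with 2 by c, and 1 with 3 by -c. *)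
Lemma mulmx_block_system gr g k al x w0 w1 w2 w3 :
  let c := gr * (x / 2) in
  let K := mode_mx g k al in
  interleave (I4 w0 w1 w2 w3) *m block_system N gr g k al x =
  interleave (I4 (c *: w2 - w0 *m K) (- c *: w3 - w1 *m K)
                 (c *: w0 - w2 *m K^T) (- c *: w1 - w3 *m K^T)).
Proof.
move=> c K; rewrite mul_mxrow_mxblock; apply/eq_mxrowP => j; apply/rowP => m.
(* The pump term is local; written as a sum over i, it can be compared with the matrix product term
   by term. *)
have delta (f : 'I_N -> F) : f j = \sum_i (if i == j then f i else 0).
  by rewrite -big_mkcond big_pred1_eq.
rewrite summxE mxE /I4; case: m => [[|[|[|[|//]]]] hm] /=; rewrite !mxE.
all: rewrite (delta (fun i => _ * _ 0 i)) -sumrN -big_split /=.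
all: apply: eq_bigr => i _; rewrite !mxE !big_ord_recl big_ord0 /= !mxE /=.
all: rewrite /block /c -!val_eqE /=; case: (ltngtP i j) => ij.
all: by rewrite ?ij !mxE -?val_eqE /= ?mulr1n ?mulr0n; ring.
Qed.

Lemma interleave_eta w :
  interleave w = interleave (I4 (w (inord 0)) (w (inord 1)) (w (inord 2)) (w (inord 3))).
Proof.
apply/eq_mxrowP => i; apply/rowP => -[[|[|[|[|//]]]] hm]; rewrite !mxE /=;
  by congr (w _ 0 i); apply/val_inj; rewrite /= inordK.
Qed.

Lemma eigenvalue_block_systemP gr g k al x l :
  eigenvalue (block_system N gr g k al x) l <->
  exists u v, (u, v) != (0, 0) /\
    coupled_modes (mode_mx g k al) (gr * (x / 2)) l u v.
Proof.
set K := mode_mx g k al; set c := gr * (x / 2).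
split=> [/eigenvalueP[z]|[u [v [uv [hu hv]]]]]; last first.
  rewrite mulmxDr mul_mx_scalar in hu; rewrite mulmxDr mul_mx_scalar in hv.
  (* The pair is placed in quadratures 0 and 2, the other two being zero. *)
  apply/eigenvalueP; exists (interleave (I4 u 0 v 0)).
    rewrite mulmx_block_system -/c -/K interleaveZ -hu -hv !addrK !scaler0.
    rewrite !mul0mx subr0; apply/eq_mxrowP => i.
    by apply/rowP => -[[|[|[|[|//]]]] hm]; rewrite !mxE ?mulr0.
  apply: contraNneq uv => z0.
  have /interleave_inj e : interleave (I4 u 0 v 0) = interleave (fun=> 0).
    by rewrite z0; apply/matrixP=> i j; rewrite !mxE.
  by have := e (inord 0); have := e (inord 2); rewrite /I4 !inordK //= => -> ->.
have [w ->] := interleave_surj z; rewrite interleave_eta.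
set w0 := w _; set w1 := w _; set w2 := w _; set w3 := w _.
rewrite mulmx_block_system -/c -/K interleaveZ => /interleave_inj e z0.
have := e (inord 0); have := e (inord 1); have := e (inord 2); have := e (inord 3).
rewrite /I4 !inordK //= => e3 e2 e1 e0.
have [w02|w02] := eqVneq (w0, w2) (0, 0); last first.
  exists w0, w2; split=> //; split; rewrite mulmxDr mul_mx_scalar.
    by rewrite -e0 subrK.
  by rewrite -e2 subrK.
(* Quadratures 1 and 3 are coupled by -c; flipping the sign of [w3] turns this into c. *)
exists w1, (- w3); split; last first.
  split; rewrite mulmxDr mul_mx_scalar ?scalerN -?scaleNr.
    by rewrite -e1 subrK.
  by rewrite scaleNr -e3 mulNmx scaleNr opprB opprK addrAC subrr add0r.
apply: contra_neq z0 => -[-> /eqP]; rewrite oppr_eq0 => /eqP ->.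
case: w02 => -> ->; apply/matrixP => a i; rewrite !mxE.
by case: (tagnat.sig2 i) => [[|[|[|[|//]]]] hm]; rewrite /= mxE.
Qed.

Lemma det_block_systemP gr g k al x :
  \det (block_system N gr g k al x) = 0 <->
  exists u v, (u, v) != (0, 0) /\
    coupled_modes (mode_mx g k al) (gr * (x / 2)) 0 u v.
Proof.
rewrite -eigenvalue_block_systemP; split=> [/eqP/det0P[z z0 zA]|/eigenvalueP[z zA z0]].
  by apply/eigenvalueP; exists z; rewrite ?scale0r.
by apply/eqP/det0P; exists z; rewrite // zA scale0r.
Qed.

Lemma mode_mx_trig g k al : is_trig_mx (mode_mx g k al).
Proof.
apply/is_trig_mxP => i j ij; rewrite !mxE -val_eqE /= ltn_eqF // ltnNge ltnW //=.
by rewrite mulr0 addr0.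
Qed.

Lemma mode_mx_diag g k al i : mode_mx g k al i i = (g + k) / 2.
Proof. by rewrite !mxE eqxx ltnn mulr0 addr0. Qed.

End Modes.

Lemma map_block_system (F G : fieldType) (f : {rmorphism F -> G}) N gr g k al x :
  map_mx f (block_system N gr g k al x) =
  block_system N (f gr) (f g) (f k) (f al) (f x).
Proof.
have f2 : f 2^-1 = 2^-1 by rewrite fmorphV rmorph_nat.
apply/matrixP => p q; rewrite !mxE.
move: (tagnat.sig1 p) (tagnat.sig1 q) => i j.
move: (tagnat.sig2 p) (tagnat.sig2 q) => u v.
rewrite /block; case: ifP => _; last case: ifP => _; rewrite !mxE;
  case: u => [[|[|[|[|//]]]] hu]; case: v => [[|[|[|[|//]]]] hv] /=;
  by rewrite ?(f2, rmorphD, rmorphN, rmorphM, rmorphXn, rmorphMn, rmorph0).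
Qed.

Lemma map_mode_mx (F G : fieldType) (f : {rmorphism F -> G}) N g k al :
  map_mx f (mode_mx N g k al) = mode_mx N (f g) (f k) (f al).
Proof.
rewrite map_mxD map_mxZ map_scalar_mx; congr (_ %:M + _ *: _).
  by rewrite rmorphM rmorphD fmorphV rmorph_nat.
by apply/matrixP => i j; rewrite !mxE; case: ifP; rewrite ?rmorphXn ?rmorph0.
Qed.

Lemma map_coupled_modes (F G : fieldType) (f : {rmorphism F -> G}) N
    (K : 'M[F]_N) c l u v :
  coupled_modes K c l u v ->
  coupled_modes (map_mx f K) (f c) (f l) (map_mx f u) (map_mx f v).
Proof.
move=> [mu mv]; split; rewrite ?map_trmx -map_scalar_mx -map_mxD -map_mxM.
  by rewrite mu map_mxZ.
by rewrite mv map_mxZ.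
Qed.

(** An index k contributes to entry (i, j) only if j <= k <= i. Serves to read off the diagonal of
    the square of [K]. *)
Lemma trig_mulmx_diag (R : pzRingType) n (A B : 'M[R]_n) :
  is_trig_mx A -> is_trig_mx B ->
  is_trig_mx (A *m B) /\ forall i, (A *m B) i i = A i i * B i i.
Proof.
move=> /is_trig_mxP tA /is_trig_mxP tB; split.
  apply/is_trig_mxP => i j ij; rewrite mxE big1 // => k _.
  case: (leqP k i) => ki; last by rewrite tA ?mul0r.
  by rewrite tB ?mulr0 // (leq_ltn_trans ki).
move=> i; rewrite mxE (bigD1 i) //= big1 ?addr0 // => k ki.
case: (ltngtP i k) => ik; first by rewrite tA ?mul0r.
  by rewrite tB ?mulr0.
by rewrite (val_inj ik) eqxx in ki.
Qed.

(** * Accretivity of the cascade *)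

Section Accretive.
Variables (R : realFieldType) (al : R).
Hypothesis hal : 0 < al <= 1.

(** The state of a first-order recursive filter running along the cascade. *)
Fixpoint discounted_sum (f : nat -> R) n : R :=
  if n is m.+1 then al * (discounted_sum f m + f m) else 0.

Lemma discounted_sumE f n :
  discounted_sum f n = \sum_(i < n) al ^+ (n - i) * f i.
Proof.
elim: n => [|n IHn]; first by rewrite big_ord0.
rewrite /= IHn big_ord_recr /= subSnn expr1 mulrDr mulr_sumr; congr (_ + _).
by apply: eq_bigr => i _; rewrite subSn ?exprS ?mulrA // ltnW.
Qed.

(* [s = discounted_sum f] satisfies [s n.+1 ^ 2 <= (s n + f n) ^ 2], and this telescopes. *)
Lemma discounted_sum_sqr f n : discounted_sum f n ^+ 2 <=
  \sum_(j < n) (f j ^+ 2 + 2 * (f j * discounted_sum f j)).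
Proof.
elim: n => [|n IHn]; first by rewrite big_ord0 expr0n.
rewrite big_ord_recr /=; set s := discounted_sum f n in IHn *.
have al1 : 0 <= 1 - al ^+ 2.
  by case/andP: hal => /ltW al0 al1; rewrite subr_ge0 expr_le1.
by have := mulr_ge0 al1 (sqr_ge0 (s + f n)); lra.
Qed.

(** Equivalent to semidefiniteness of the kernel al^|i - j|. With L the cascade matrix, the
    telescoped bound reads 0 <= s_n^2 <= |u|^2 + 2 <u L, u>. *)
Lemma cascade_form_ge n (u : 'rV[R]_n) :
  - (dot u u / 2) <= dot (u *m cascade_mx n al) u.
Proof.
case: n u => [|n] u; first by rewrite !dotE !big_ord0 mul0r oppr0.
(* [inord] needs a nonempty index type, hence the separate case of dimension 0. *)
pose f k := u 0 (inord k).
have fE (i : 'I_n.+1) : u 0 i = f i by rewrite /f inord_val.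
suff -> : dot (u *m cascade_mx n.+1 al) u =
    \sum_(j < n.+1) f j * discounted_sum f j.
  have -> : dot u u = \sum_(j < n.+1) f j ^+ 2.
    by rewrite dotE; apply: eq_bigr => j _; rewrite fE.
  have := discounted_sum_sqr f n.+1; have := sqr_ge0 (discounted_sum f n.+1).
  by rewrite big_split -mulr_sumr /=; lra.
rewrite dot_mulmx dotE; apply: eq_bigr => j _; rewrite fE mxE; congr (_ * _).
rewrite discounted_sumE (big_ord_widen _ (fun i => al ^+ (j - i) * f i) (ltnW (ltn_ord j))).
rewrite [RHS]big_mkcond; apply: eq_bigr => i _; rewrite !mxE fE mulrC.
by case: ifP => _; rewrite ?mul0r.
Qed.

(** The cascade contributes at least -g/2 times |u|^2, which the g/2 on the diagonal absorbs
    exactly; k/2 is left over. *)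
Lemma mode_form_ge0 n g k (u : 'rV[R]_n) : 0 < g -> 0 <= k ->
  0 <= dot (u *m mode_mx n g k al) u.
Proof.
move=> g0 k0; rewrite mulmxDr mul_mx_scalar -scalemxAr dotDl !dotZl.
by have := cascade_form_ge u; have := dot_ge0 u; nra.
Qed.

End Accretive.

(** * Stability criterion for a coupled pair of modes *)

Section Stability.
Variables (R : realType) (n : nat) (K : 'M[R]_n) (c : R).
Hypotheses (c_gt0 : 0 < c) (K_ge0 : forall u, 0 <= dot (u *m K) u).
Implicit Types (u v : 'rV[R]_n) (z w : 'rV[R[i]]_n).

(** The result of eliminating [v] at l = 0; it is positive definite when |u K| > c |u| for all
    nonzero u. *)
Definition gap_mx : 'M[R]_n := K *m K^T - (c ^+ 2)%:M.

Lemma sym_part_form u : dot (u *m (K + K^T)) u = 2 * dot (u *m K) u.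
Proof.
by rewrite mulmxDr dotDl [dot (u *m K^T) u]dot_mulmx trmxK (dotC u); ring.
Qed.

Lemma gap_form u :
  dot (u *m gap_mx) u = dot (u *m K) (u *m K) - c ^+ 2 * dot u u.
Proof.
rewrite mulmxBr dotBl mul_mx_scalar dotZl mulmxA; congr (_ - _).
by rewrite dot_mulmx trmxK.
Qed.

Lemma gap_mx_sym : gap_mx^T = gap_mx.
Proof. by rewrite /gap_mx linearB /= trmx_mul trmxK tr_scalar_mx. Qed.

(** With s = -l the pencil is (l + K)(l + K^T) - c^2. It is definite at l = c + 1, where l^2 > c^2,
    and not at l = 0, hence singular at some l between. *)
Lemma unstable_mode : ~ posdef gap_mx ->
  exists2 l, 0 <= l & exists u v, (u, v) != (0, 0) /\ coupled_modes K c l u v.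
Proof.
move=> npd.
have symB : (- (K + K^T))^T = - (K + K^T).
  by rewrite linearN linearD /= trmxK addrC.
have E s : pencil gap_mx (- (K + K^T)) 1%:M s =
    ((- s)%:M + K) *m ((- s)%:M + K^T) - (c ^+ 2)%:M.
  rewrite /pencil mulmxDl !mulmxDr -scalar_mxM !mul_scalar_mx mul_mx_scalar.
  rewrite /gap_mx !scalerN !scaleNr scalerDr scale_scalar_mx mulr1 mulrNN -expr2.
  apply/matrixP => i j; rewrite !mxE; ring.
have := @pencil_singular R n gap_mx (- (K + K^T)) 1%:M gap_mx_sym symB (trmx1 _ _).
move=> /(_ (- (c + 1)) 0)[||| s /andP[_ s0] /eqP/det0P[u u0]].
- by have := c_gt0; lra.
- move=> u u0; rewrite pencil_form mulmxN dotNl sym_part_form mulmx1 gap_form.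
  have := c_gt0; have := dot_ge0 (u *m K); have := K_ge0 u.
  by move: u0; rewrite -dot_gt0; nra.
- by rewrite /pencil scale0r addr0 expr0n scale0r addr0.
rewrite E mulmxBr mulmxA mul_mx_scalar => /eqP; rewrite subr_eq0 => /eqP uE.
exists (- s); first by rewrite oppr_ge0.
(* [v] is read off from the first mode equation. *)
exists u, (c^-1 *: (u *m ((- s)%:M + K))); split.
  by apply: contra_neq u0 => -[].
split; first by rewrite scalerA divff ?gt_eqF // scale1r.
by rewrite -scalemxAl uE scalerA expr2 mulrA mulVf ?gt_eqF // mul1r.
Qed.

(** The coupled modes in real coordinates: l = p + i q, u = a + i b, v = e + i f. *)
Lemma stable_real_mode p q (a b e f : 'rV[R]_n) :
  is_trig_mx K -> posdef gap_mx ->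
  p *: a - q *: b + a *m K = c *: e -> p *: b + q *: a + b *m K = c *: f ->
  p *: e - q *: f + e *m K^T = c *: a -> p *: f + q *: e + f *m K^T = c *: b ->
  0 <= p -> [/\ a = 0, b = 0, e = 0 & f = 0].
Proof.
move=> Ktrig pd eqa eqb eqe eqf p0.
have kill (x y : 'rV[R]_n) : c *: x = y -> y = 0 -> x = 0.
  by move=> <- /eqP; rewrite scaler_eq0 gt_eqF // => /eqP.
suff [a0 b0] : a = 0 /\ b = 0.
  split=> //; first by apply: kill (esym eqa) _; rewrite a0 b0 !scaler0 mul0mx subrr addr0.
  by apply: kill (esym eqb) _; rewrite a0 b0 !scaler0 mul0mx !addr0.
have [/eqP e0|nn_neq0] := eqVneq (dot a a + dot b b) 0.
  by move: e0; rewrite paddr_eq0 ?dot_ge0 // !dot_eq0 => /andP[/eqP a0 /eqP b0].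
set nn := _ + _ in nn_neq0.
have nn0 : 0 < nn by rewrite lt_def nn_neq0 addr_ge0 ?dot_ge0.
have hC : 0 < dot (a *m gap_mx) a + dot (b *m gap_mx) b.
  have [a0|a0] := eqVneq a 0; last first.
    by rewrite ltr_pwDl ?pd // posdef_psd.
  rewrite a0 mul0mx dot0l add0r; apply: pd; apply: contra_neq nn_neq0 => b0.
  by rewrite /nn a0 b0 !dot0l addr0.
have simE x : c * dot e x = p * dot a x - q * dot b x + dot (a *m K) x.
  by rewrite -dotZl -eqa !(dotDl, dotNl, dotZl).
have simF x : c * dot f x = p * dot b x + q * dot a x + dot (b *m K) x.
  by rewrite -dotZl -eqb !dotDl !dotZl.
have simA x : c * dot a x = p * dot e x - q * dot f x + dot e (x *m K).
  by rewrite -dotZl -eqe !(dotDl, dotNl, dotZl) dot_mulmx trmxK.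
have simB x : c * dot b x = p * dot f x + q * dot e x + dot f (x *m K).
  by rewrite -dotZl -eqf !(dotDl, dotZl) dot_mulmx trmxK.
have h_ge0 := addr_ge0 (K_ge0 a) (K_ge0 b).
set h := _ + _ in h_ge0.
(* Eliminating v and pairing with u gives l^2 |u|^2 + 2 l h + <u gap, u> = 0; these are its real
   part and half its imaginary part. *)
have [re im] : (p ^+ 2 - q ^+ 2) * nn + 2 * p * h +
      (dot (a *m gap_mx) a + dot (b *m gap_mx) b) = 0 /\ q * (p * nn + h) = 0.
  have EA x : c ^+ 2 * dot a x =
      p * (p * dot a x - q * dot b x + dot (a *m K) x)
      - q * (p * dot b x + q * dot a x + dot (b *m K) x)
      + (p * dot a (x *m K) - q * dot b (x *m K) + dot (a *m K) (x *m K)).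
    by rewrite -!simE -simF expr2 -mulrA simA; ring.
  have EB x : c ^+ 2 * dot b x =
      p * (p * dot b x + q * dot a x + dot (b *m K) x)
      + q * (p * dot a x - q * dot b x + dot (a *m K) x)
      + (p * dot b (x *m K) + q * dot a (x *m K) + dot (b *m K) (x *m K)).
    by rewrite -simE -!simF expr2 -mulrA simB; ring.
  have := EA a; have := EB b; have := EA b; have := EB a.
  rewrite !gap_form (dotC b a) (dotC a (a *m _)) (dotC a (b *m _)).
  rewrite (dotC b (b *m _)) (dotC b (a *m _)) (dotC (b *m K) (a *m K)).
  by rewrite /nn /h; split; lra.
(* If q = 0, the real part is a sum of nonnegative terms, one of them positive. So q is nonzero, and
   the nonnegative terms p nn and h sum to 0. *)
have {re} [p_eq0 h_eq0] : p = 0 /\ h = 0.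
  have q0 : q != 0.
    apply/eqP => q0; move: re; rewrite q0; apply/eqP; rewrite gt_eqF //.
    rewrite expr0n subr0 ltr_wpDl // addr_ge0 //.
      exact: mulr_ge0 (sqr_ge0 p) (ltW nn0).
    by rewrite !mulr_ge0.
  have : p * nn + h = 0.
    by apply/eqP; move/eqP: im; rewrite mulf_eq0 (negbTE q0).
  move/eqP; rewrite paddr_eq0 ?(mulr_ge0 p0 (ltW nn0)) // mulf_eq0.
  by rewrite (negbTE nn_neq0) orbF => /andP[/eqP-> /eqP->].
subst p; rewrite !scale0r ?sub0r ?add0r in eqa eqb eqe eqf.
(* On the imaginary axis, c (<a, e> + <b, f>) equals the total [K]-form of either pair. *)
have energy : dot (e *m K) e + dot (f *m K) f = h.
  rewrite /h; have := simE a; have := simF b; have := simA e; have := simB f.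
  rewrite (dotC e a) (dotC f b) (dotC e (_ *m _)) (dotC f (_ *m _)).
  rewrite (dotC b a) (dotC f e); lra.
(* A vector at which the semidefinite form of K + K^T vanishes lies in its kernel. *)
have anti u : dot (u *m K) u = 0 -> u *m K^T = - (u *m K).
  move=> u0; apply/eqP; rewrite -addr_eq0 addrC -mulmxDr; apply/eqP.
  apply: psd_null => [|w|]; rewrite ?sym_part_form ?u0 ?mulr0 //.
    by rewrite linearD /= trmxK addrC.
  by rewrite mulr_ge0.
move: energy; rewrite h_eq0 => /eqP; rewrite paddr_eq0 // => /andP[/eqP e0 /eqP f0].
move/eqP: h_eq0; rewrite /h paddr_eq0 // => /andP[/eqP a0 /eqP b0].
rewrite (anti e e0) in eqe; rewrite (anti f f0) in eqf.
(* With K^T acting as -K on e and f, eliminating these gives a T = b T = 0; T is lower triangular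
   with diagonal entries K_ii^2 + c^2 + q^2 > 0. *)
pose T : 'M[R]_n := K *m K + (c ^+ 2 + q ^+ 2)%:M.
have [Ttrig Tdiag] := trig_mulmx_diag Ktrig Ktrig.
have detT : \det T != 0.
  rewrite det_trig; last first.
    apply/is_trig_mxP => i j ij; rewrite mxE (is_trig_mxP Ttrig) // mxE.
    by rewrite -val_eqE /= ltn_eqF // addr0.
  apply/prodf_neq0 => i _; rewrite mxE Tdiag mxE eqxx mulr1n -expr2 gt_eqF //.
  by have := sqr_ge0 (K i i); have := sqr_ge0 q; have := exprn_gt0 2 c_gt0; lra.
have Tnull u : u *m T = 0 -> u = 0.
  move=> uT; apply/eqP; apply: contraNT detT => u0; apply/det0P; by exists u.
have TE u : u *m T = u *m K *m K + c *: (c *: u) + q *: (q *: u).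
  by rewrite mulmxDr mul_mx_scalar mulmxA scalerDl !scalerA -!expr2 addrA.
split; apply: Tnull; rewrite TE.
  rewrite -eqe !(scalerDr, scalerN) [c *: (q *: f)]scalerA (mulrC c q) -scalerA -eqb.
  rewrite [c *: (e *m K)]scalemxAl -eqa mulmxDl mulNmx -!scalemxAl scalerDr.
  by apply/rowP => i; rewrite !mxE; ring.
rewrite -eqf !(scalerDr, scalerN) [c *: (q *: e)]scalerA (mulrC c q) -scalerA -eqa.
rewrite [c *: (f *m K)]scalemxAl -eqb mulmxDl -!scalemxAl scalerDr scalerN.
by apply/rowP => i; rewrite !mxE; ring.
Qed.

(** Real and imaginary parts commute with multiplication by real matrices, which reduces this to
    [stable_real_mode]. *)
Lemma stable_mode l z w : is_trig_mx K -> posdef gap_mx ->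
  coupled_modes (map_mx (real_complex R) K) (real_complex R c) l z w ->
  0 <= complex.Re l -> (z, w) = (0, 0).
Proof.
move=> Ktrig pd.
pose re := map_mx (@complex.Re R); pose im := map_mx (@complex.Im R).
have reZ t x : re 1%N n (t *: x) = complex.Re t *: re _ _ x - complex.Im t *: im _ _ x.
  by apply/rowP => i; rewrite !mxE; case: t => ? ?; case: (x 0 i).
have imZ t x : im 1%N n (t *: x) = complex.Re t *: im _ _ x + complex.Im t *: re _ _ x.
  by apply/rowP => i; rewrite !mxE; case: t => ? ?; case: (x 0 i).
have reD x y : re 1%N n (x + y) = re _ _ x + re _ _ y.
  by apply/rowP => i; rewrite !mxE; case: (x 0 i) => ? ?; case: (y 0 i).
have imD x y : im 1%N n (x + y) = im _ _ x + im _ _ y.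
  by apply/rowP => i; rewrite !mxE; case: (x 0 i) => ? ?; case: (y 0 i).
have reM x W : re 1%N n (x *m map_mx (real_complex R) W) = re _ _ x *m W.
  apply/rowP => i; rewrite !mxE.
  rewrite (big_morph (@complex.Re R) (id1 := 0) (op1 := +%R)) // => [|[? ?] [? ?] //].
  by apply: eq_bigr => j _; rewrite !mxE; case: (x 0 j) => ? ? /=; rewrite mulr0 subr0.
have imM x W : im 1%N n (x *m map_mx (real_complex R) W) = im _ _ x *m W.
  apply/rowP => i; rewrite !mxE.
  rewrite (big_morph (@complex.Im R) (id1 := 0) (op1 := +%R)) // => [|[? ?] [? ?] //].
  by apply: eq_bigr => j _; rewrite !mxE; case: (x 0 j) => ? ? /=; rewrite mulr0 add0r.
move=> [hz hw] l0; rewrite map_trmx in hw.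
rewrite mulmxDr mul_mx_scalar in hz; rewrite mulmxDr mul_mx_scalar in hw.
have rez := congr1 (re _ _) hz; have imz := congr1 (im _ _) hz.
have rew := congr1 (re _ _) hw; have imw := congr1 (im _ _) hw.
rewrite !(reD, imD, reZ, imZ, reM, imM) /= in rez imz rew imw.
rewrite scale0r subr0 in rez; rewrite scale0r addr0 in imz.
rewrite scale0r subr0 in rew; rewrite scale0r addr0 in imw.
have [za zb wa wb] := stable_real_mode Ktrig pd rez imz rew imw l0.
have zero x : re 1%N n x = 0 -> im 1%N n x = 0 -> x = 0.
  move=> /rowP x1 /rowP x2; apply/rowP => i; have := x1 i; have := x2 i.
  by rewrite !mxE; case: (x 0 i) => ? ? /= -> ->.
by congr (_, _); apply: zero.
Qed.

End Stability.

(** * The network as a function of the pump parameter *)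

Section Network.
Variables (R : realType) (N : nat) (y alpha : R) (amp : bool).
Hypotheses (hy : 0 < y <= 1) (halpha : 0 < alpha <= 1).

Definition network_mode_mx x : 'M[R]_N :=
  mode_mx N (gamma y) (kappa_coef R amp * x) alpha.

Definition pump x : R := gamma_r R * (x / 2).

Definition network_gap x : 'M[R]_N := gap_mx (network_mode_mx x) (pump x).

Lemma gamma_r_gt0 : 0 < gamma_r R.
Proof. by rewrite /gamma_r mulr_gt0 ?divr_gt0 ?exprn_gt0 ?ltr0n. Qed.

Lemma gamma_gt0 : 0 < gamma y.
Proof. by case/andP: hy => y0 _; rewrite divr_gt0 ?gamma_r_gt0. Qed.

(** From sqrt 2 >= 1, the loss coefficient is at most 5 10^6, against 7.2 10^7 for [gamma_r]. *)
Lemma kappa_coef_bounds : 0 <= kappa_coef R amp <= gamma_r R.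
Proof.
rewrite /kappa_coef; case: amp; last by rewrite lexx ltW ?gamma_r_gt0.
have sq : 1 <= Num.sqrt (2 : R) by rewrite -[leLHS]sqrtr1 ler_sqrt // ler1n.
apply/andP; split.
  by rewrite !(divr_ge0, mulr_ge0, exprn_ge0, sqrtr_ge0, ler0n).
rewrite ler_pdivrMr; last by rewrite mulr_gt0 ?divr_gt0 ?ltr0n // (lt_le_trans ltr01).
rewrite /gamma_r exprS; have : 0 < (10 : R) ^+ 6 by rewrite exprn_gt0 ?ltr0n.
move: (10 ^+ 6) (Num.sqrt 2) sq => t r r1 t0.
by have := ler_wpM2l (ltW t0) r1; lra.
Qed.

Lemma pump_gt0 x : 0 < x -> 0 < pump x.
Proof. by move=> x0; rewrite mulr_gt0 ?gamma_r_gt0 ?divr_gt0 ?ltr0n. Qed.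

Lemma network_mode_ge0 x u : 0 <= x -> 0 <= dot (u *m network_mode_mx x) u.
Proof.
move=> x0; case/andP: kappa_coef_bounds => k0 _.
by rewrite mode_form_ge0 ?gamma_gt0 ?mulr_ge0.
Qed.

Lemma network_mode_mxD s t :
  network_mode_mx (s + t) = network_mode_mx s + (kappa_coef R amp * t / 2)%:M.
Proof.
rewrite /network_mode_mx /mode_mx addrAC -raddfD; congr (_%:M + _).
by rewrite mulrDr addrA mulrDl.
Qed.

Lemma hurwitz_posdef x : 0 < x ->
  hurwitz (AN N y alpha amp x) <-> posdef (network_gap x).
Proof.
move=> x0; have c0 := pump_gt0 x0.
have Kge0 u := network_mode_ge0 u (ltW x0).
have modesP l : eigenvalue (map_mx (real_complex R) (AN N y alpha amp x)) l <->
    exists u v, (u, v) != (0, 0) /\ coupled_modes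
      (map_mx (real_complex R) (network_mode_mx x)) (real_complex R (pump x)) l u v.
  rewrite /AN map_block_system eigenvalue_block_systemP map_mode_mx.
  suff -> : real_complex R (pump x) = real_complex R (gamma_r R) * (real_complex R x / 2) by [].
  by rewrite /pump rmorphM [X in _ * X]rmorphM fmorphV rmorph_nat.
split=> [hur|pd l /modesP[u [v [uv m]]]]; last first.
  rewrite ltNge; apply: contra_neqN uv => l0.
  by apply: (stable_mode c0 Kge0 _ pd m l0); exact: mode_mx_trig.
apply: contrapT => /(unstable_mode c0 Kge0)[l l0 [u [v [uv m]]]].
(* The unstable mode is real; it is carried over to the complex numbers. *)
suff /hur : eigenvalue (map_mx (real_complex R) (AN N y alpha amp x)) (real_complex R l).
  by rewrite /= ltNge l0.
apply/modesP; exists (map_mx (real_complex R) u), (map_mx (real_complex R) v).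
split.
  apply: contra_neq uv => -[/eqP u0 /eqP v0]; move: u0 v0.
  by rewrite !map_mx_eq0 => /eqP-> /eqP->.
exact: (map_coupled_modes (real_complex R) m).
Qed.

(** At l = 0 the mode equations reduce to u K K^T = c^2 u, and v = u K / c is recovered since c >
    0. *)
Lemma det_AN_gap x : 0 < x ->
  \det (AN N y alpha amp x) = 0 <-> \det (network_gap x) = 0.
Proof.
move=> x0; have c0 := pump_gt0 x0; rewrite det_block_systemP -/(network_mode_mx x).
rewrite -/(pump x); set K := network_mode_mx x; set c := pump x in c0 *.
split=> [[u [v [uv []]]]|/eqP/det0P[u u0]]; rewrite ?(raddf0 (scalar_mx : R -> 'M_N)) ?add0r.
  move=> eu ev; apply/eqP/det0P; exists u.
    apply: contra_neq uv => u0; rewrite u0; congr (_, _).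
    by apply/eqP; have /eqP := eu; rewrite u0 mul0mx eq_sym scaler_eq0 gt_eqF.
  by rewrite mulmxBr mulmxA eu -scalemxAl ev scalerA -expr2 mul_mx_scalar subrr.
rewrite mulmxBr mulmxA mul_mx_scalar => /eqP; rewrite subr_eq0 => /eqP uE.
exists u, (c^-1 *: (u *m K)); split.
  by apply: contra_neq u0 => -[].
rewrite /coupled_modes raddf0 !add0r scalerA divff ?gt_eqF // scale1r; split=> //.
by rewrite -scalemxAl uE scalerA expr2 mulrA mulVf ?gt_eqF // mul1r.
Qed.

(** The loss rate is linear in the pump, so K(s) = K(0) + k s and the gap is quadratic in s. *)
Lemma network_gap_pencil s : network_gap s =
  let K := network_mode_mx 0 in let k := kappa_coef R amp / 2 in
  pencil (K *m K^T) (k *: (K + K^T)) (k ^+ 2 - (gamma_r R / 2) ^+ 2)%:M s.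
Proof.
rewrite /network_gap -[s in network_mode_mx s]add0r network_mode_mxD /gap_mx /=.
move: (network_mode_mx 0) => K; rewrite linearD /= tr_scalar_mx.
rewrite mulmxDl !mulmxDr -scalar_mxM !mul_scalar_mx mul_mx_scalar /pencil.
rewrite !scalerDr !scalerA scale_scalar_mx.
have -> : kappa_coef R amp * s / 2 = s * (kappa_coef R amp / 2) by field.
rewrite -!addrA -raddfN -raddfD; do 3!congr (_ + _); apply: (congr1 scalar_mx).
by rewrite /pump; field.
Qed.

(** Without pump the form is |u K|^2, and [K] is triangular with gamma / 2 on its diagonal. *)
Lemma network_gap0_posdef : posdef (network_gap 0).
Proof.
move=> u u0; rewrite gap_form /pump mul0r mulr0 expr0n mul0r subr0 dot_gt0.
apply: contra_neq u0 => uK.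
suff detK : \det (network_mode_mx 0) != 0.
  by apply/eqP; apply: contraNT detK => u0; apply/det0P; exists u.
rewrite det_trig ?mode_mx_trig //; apply/prodf_neq0 => i _.
by rewrite mode_mx_diag mulr0 addr0 gt_eqF // divr_gt0 ?gamma_gt0.
Qed.

Lemma network_gap_singular x : 0 < x -> ~ posdef (network_gap x) ->
  exists2 s, 0 < s <= x & \det (network_gap s) = 0.
Proof.
rewrite network_gap_pencil => x0 npd; have := network_gap0_posdef.
rewrite network_gap_pencil => pd0.
have [||| s sx ds] := pencil_singular _ _ _ x0 pd0 npd.
- by rewrite trmx_mul trmxK.
- by rewrite linearZ linearD /= trmxK addrC.
- by rewrite tr_scalar_mx.
by exists s => //; rewrite network_gap_pencil.
Qed.

(* From [|u K s| <= c s |u|] and [kappa_coef <= gamma_r], the triangle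
   inequality bounds [|u K t|] by [c t |u|] for [t >= s]. *)
Lemma network_gap_not_posdef s t u : 0 < s -> s <= t ->
  dot (u *m network_gap s) u <= 0 -> dot (u *m network_gap t) u <= 0.
Proof.
move=> s0 st; rewrite !gap_form !subr_le0.
have -> : network_mode_mx t = network_mode_mx s + (kappa_coef R amp * (t - s) / 2)%:M.
  by rewrite -network_mode_mxD addrC subrK.
have -> : pump t = pump s + gamma_r R * (t - s) / 2 by rewrite /pump; field.
have /andP[k0 kg] := kappa_coef_bounds.
move: (network_mode_mx s) (pump s) (pump_gt0 s0) (network_mode_ge0 u (ltW s0)) => K c c0.
(* [d] is the growth of the diagonal of K from s to t and [e] that of the pump; d <= e since
   [kappa_coef] is at most [gamma_r]. *)
set d := _ * _ / 2; set e := _ * _ / 2.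
have d0 : 0 <= d by rewrite !mulr_ge0 ?invr_ge0 ?ler0n // subr_ge0.
have de : d <= e by rewrite ler_pM2r ?invr_gt0 ?ltr0n // ler_wpM2r // subr_ge0.
rewrite mulmxDr mul_mx_scalar !(dotDl, dotDr, dotZl, dotZr) (dotC u (u *m K)).
have := cauchy_schwarz (u *m K) u; have := dot_ge0 u.
move: (dot u u) (dot (u *m K) u) (dot (u *m K) (u *m K)) => n2 m q n0 cs m0 qc.
(* From m^2 <= q n2 <= (c n2)^2. *)
have mc : m <= c * n2.
  have cn0 : 0 <= c * n2 by rewrite mulr_ge0 // ltW.
  rewrite -(@ler_pXn2r _ 2) ?nnegrE //; apply: le_trans cs _.
  by rewrite exprMn [n2 ^+ 2]expr2 mulrA ler_wpM2r.
have h1 : d * m <= e * (c * n2) by apply: ler_pM.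
have h2 : d * d * n2 <= e * e * n2 by apply: ler_wpM2r => //; apply: ler_pM.
clearbody d e; lra.
Qed.

End Network.

Unset Implicit Arguments.

Theorem theorem2 (R : realType) (N : nat) (y alpha : R) (amp : bool)
    (x x_th : R)
    (hN : (2 <= N)%N)
    (hy : 0 < y <= 1)
    (halpha : 0 < alpha <= 1)
    (hx : 0 < x <= 1)
    (hroot : smallest_positive_root (\det (AN_poly N y alpha amp)) x_th)
    (hx_th : x_th <= 1) :
  hurwitz (AN N y alpha amp x) <-> 0 < x < x_th.
Proof.
case/andP: hx => x0 _; case: hroot => th0 rth minth.
rewrite x0 /= hurwitz_posdef //; split=> [pd|xth].
  rewrite ltNge; apply/negP => thx.
  (* A null vector of the gap at [x_th] keeps a nonpositive form value at [x]. *)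
  have /(det_AN_gap _ _ _ _ th0)/eqP/det0P[u u0 uG] :
      \det (AN N y alpha amp x_th) = 0.
    by rewrite -horner_det_AN_poly; apply/rootP.
  have := pd u u0; rewrite ltNge (network_gap_not_posdef hy halpha th0 thx) //.
  by rewrite uG dot0l.
apply: contrapT => npd.
(* Lost definiteness yields a positive root of the determinant at most [x], hence below [x_th]. *)
have [s /andP[s0 sx] ds] := network_gap_singular hy x0 npd.
suff : x_th <= s by rewrite leNgt (le_lt_trans sx xth).
by apply: minth => //; apply/rootP; rewrite horner_det_AN_poly; apply/det_AN_gap.
Qed.
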